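(* Let $A$ be a distributive meet-semilattice. The collection of frames with D-base $A$ coincides with the interval $[D_\infty A,\mathcal{I}DA]$ in the coframe of sublocales of $\mathcal{D}A$. That is, under the identifications described in the context: every sublocale $L$ of $\mathcal{D}A$ with $D_\infty A\subseteq L\subseteq\mathcal{I}DA$ is a frame having $A$ as a D-base, and every frame $L$ with D-base $A$, regarded as a sublocale of $\mathcal{D}A$, satisfies $D_\infty A\subseteq L\subseteq\mathcal{I}DA$.
   Context: A meet-semilattice $A$ (a poset with binary meets, not necessarily bounded) is distributive if $a\wedge b\le c$ implies there are $a'\ge a$, $b'\ge b$ with $a'\wedge b'=c$. A sup-morphism between distributive meet-semilattices preserves binary meets and all existing finite joins (including the empty join, i.e. the least element, if it exists). A subset $A$ of a frame $L$ is a base if every element of $L$ is a join of elements of $A$; a base $A$ is a D-base if $A$ is a distributive meet-semilattice and the embedding $A\hookrightarrow L$ is a sup-morphism. $\mathcal{D}A$ is the frame of all downsets of $A$ (including $\varnothing$) under inclusion. $A$ is identified with $\{{\downarrow}a:a\in A\}\subseteq\mathcal{D}A$, and any frame $L$ in which $A$ is a base closed under binary meets is identified with the sublocale $\{\{a\in A:a\le x\}:x\in L\}$ of $\mathcal{D}A$. Sublocales are ordered by inclusion. A subset $G\subseteq A$ is admissible if $\bigvee G$ exists in $A$ and for each $a\in A$ the join $\bigvee\{a\wedge y: y\in G\}$ exists in $A$ and equals $a\wedge\bigvee G$. A downset $E$ of $A$ is a D-ideal if $\bigvee G\in E$ for each admissible $G\subseteq E$. $D_\infty A$ is the frame of D-ideals,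 which is a sublocale of $\mathcal{D}A$. Distributive envelope $DA$: a filter of $A$ is a nonempty upset closed under binary meets; a filter $P$ is prime if it is a meet-prime element of the lattice of filters ($P\neq A$, and $F\cap G\subseteq P$ implies $F\subseteq P$ or $G\subseteq P$). With $X_A$ the set of prime filters and $\mathfrak{s}(a)=\{P\in X_A:a\in P\}$, $DA$ is the sublattice of $\wp(X_A)$ generated by $\mathfrak{s}[A]$, i.e. the set of finite nonempty unions of sets $\mathfrak{s}(a)$; $A$ is identified with $\mathfrak{s}[A]\subseteq DA$. $\mathcal{I}DA$ is the frame of ideals of the distributive lattice $DA$ under inclusion (with $\varnothing$ added as least element if $DA$ has no least element); it has $A$ as a base via principal ideals, and is accordingly identified with the sublocale $\{I\cap A: I\in\mathcal{I}DA\}$ of $\mathcal{D}A$. *)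

(* Defs.v *)
From HB Require Import structures.
From mathcomp Require Import all_boot all_order.
From mathcomp Require Import boolp classical_sets functions cardinality.

Set Implicit Arguments.
Unset Strict Implicit.
Unset Printing Implicit Defensive.

Local Open Scope classical_set_scope.
Local Open Scope order_scope.

(* The induced order on a subset of a poset. *)
Section InducedOrder.
Variables (d : Order.disp_t) (L : porderType d) (S : set L).
HB.instance Definition _ := SubChoice.on (set_type S).
HB.instance Definition _ := [SubChoice_isSubPOrder of set_type S by <: with d].
End InducedOrder.

(* [supremums X s] and [infimums X m] say that [s], [m] are the least upper
   bound and the greatest lower bound of [X].  Frames are posets with a
   property, so that subsets of a frame, with the induced order, can be said
   to be frames. *)
Definition is_frame (d : Order.disp_t) (L : porderType d) : Prop :=
  (forall X : set L, supremums X !=set0) /\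
  (forall (X : set L) (x s m : L),
     supremums X s -> infimums [set x; s] m ->
     supremums [set z | exists2 y, X y & infimums [set x; y] z] m).

(* [h] is [x => y]: [z <= h] iff the meet of [z] and [x] is below [y]. *)
Definition is_heyting_imp (d : Order.disp_t) (L : porderType d)
    (x y h : L) : Prop :=
  forall z : L, z <= h <-> (forall m, infimums [set z; x] m -> m <= y).

Definition is_sublocale (d : Order.disp_t) (L : porderType d)
    (S : set L) : Prop :=
  (forall (X : set L) (m : L), X `<=` S -> infimums X m -> S m) /\
  (forall x s h : L, S s -> is_heyting_imp x s h -> S h).

Definition is_base (d : Order.disp_t) (L : porderType d) (B : set L) : Prop :=
  forall x : L, exists2 X : set L, X `<=` B & supremums X x.

Section MeetSemilattice.
Variables (d : Order.disp_t) (A : meetSemilatticeType d).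

Definition distributive_semilattice : Prop :=
  forall a b c : A, Order.meet a b <= c ->
  exists a' b' : A, [/\ a <= a', b <= b' & Order.meet a' b' = c].

(* The case [F = set0] is preservation of the least element. *)
Definition sup_morphism (d' : Order.disp_t) (L : porderType d')
    (i : A -> L) : Prop :=
  (forall a b : A, infimums [set i a; i b] (i (Order.meet a b))) /\
  (forall (F : set A) (s : A),
     finite_set F -> supremums F s -> supremums (i @` F) (i s)).

(* An order embedding [i] plays the role of the inclusion of a subset A of L. *)
Definition is_Dbase (d' : Order.disp_t) (L : porderType d')
    (i : A -> L) : Prop :=
  [/\ forall a b : A, (i a <= i b) = (a <= b),
      is_base (range i),
      distributive_semilattice
    & sup_morphism i].

Definition is_downset (E : set A) : Prop :=
  forall a b : A, a <= b -> E b -> E a.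

(* The frame of downsets, as a subtype of [set A], whose order is inclusion. *)
Definition downsets : Type := set_type [set E : set A | is_downset E].
HB.instance Definition _ := Order.SubPOrder.on downsets.

Lemma principal_subproof (a : A) :
  [set b : A | b <= a] \in [set E : set A | is_downset E].
Proof. by rewrite inE => x y xy ya; apply: Order.POrderTheory.le_trans ya. Qed.

Definition principal (a : A) : downsets := exist (fun E => E \in _) _ (principal_subproof a).

(* For a frame with base A, embedded by [i], [x] is identified with
   [{a | i a <= x}]. *)
Definition sublocale_of (d' : Order.disp_t) (L : porderType d')
    (i : A -> L) : set downsets :=
  [set E | exists x : L, val E = [set a | i a <= x]].

Definition admissible (G : set A) : Prop :=
  exists2 g : A, supremums G g &
    forall a : A, supremums [set Order.meet a y | y in G] (Order.meet a g).

Definition Dideals : set downsets :=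
  [set E | forall (G : set A) (g : A),
     admissible G -> G `<=` val E -> supremums G g -> val E g].

Definition is_filter (P : set A) : Prop :=
  [/\ P !=set0,
      forall a b : A, a <= b -> P a -> P b
    & forall a b : A, P a -> P b -> P (Order.meet a b)].

Definition is_prime_filter (P : set A) : Prop :=
  [/\ is_filter P,
      P <> setT
    & forall F G : set A, is_filter F -> is_filter G ->
        F `&` G `<=` P -> F `<=` P \/ G `<=` P].

Definition prime_filters : Type := set_type [set P : set A | is_prime_filter P].

Definition spec (a : A) : set prime_filters := [set P | val P a].

Definition envelope : set (set prime_filters) :=
  [set U | exists F : set A,
     [/\ finite_set F, F !=set0 & U = \bigcup_(a in F) spec a]].

Definition is_envelope_ideal (I : set (set prime_filters)) : Prop :=
  [/\ I `<=` envelope,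
      I !=set0,
      forall U V, envelope U -> I V -> U `<=` V -> I U
    & forall U V, I U -> I V -> I (U `|` V)].

Definition envelope_ideals : set (set (set prime_filters)) :=
  [set I | is_envelope_ideal I \/
     I = set0 /\ ~ (exists2 U, envelope U & forall V, envelope V -> U `<=` V)].

(* [spec @^-1` I] is the trace of the ideal [I] on A. *)
Definition envelope_sublocale : set downsets :=
  [set E | exists2 I, envelope_ideals I & val E = spec @^-1` I].

End MeetSemilattice.

Arguments distributive_semilattice {d} A.
Arguments Dideals {d} A.
Arguments envelope_sublocale {d} A.

(* Main.v *)
Require Import Defs.
From mathcomp Require Import all_boot all_order.
From mathcomp Require Import boolp classical_sets functions cardinality.

Set Implicit Arguments.
Unset Strict Implicit.
Unset Printing Implicit Defensive.

Import Order.Theory.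

Local Open Scope order_scope.
Local Open Scope classical_set_scope.

(** Everything rests on an intrinsic description of both ends of the interval
    by closure under joins of [A].  The D-ideals are by definition the downsets
    closed under all admissible joins.  The claim about the envelope is that
    the traces on [A] of its ideals are the downsets closed under the finite
    admissible joins, and that in a distributive [A] every existing finite join
    is admissible (the empty join being the least element).

    To see this, let [F] be a finite set.  If [spec a] is covered by the
    [spec f] with [f] in [F], then [a] is the join of the [a /\ f]: were an
    upper bound [u] not above [a], some prime filter would contain [a] but not
    [u], while it contains some [a /\ f].  This join is admissible since the
    hypothesis is inherited by each [b /\ a].  Conversely, for nonempty [F], if
    [s] is the join of [F] then the [spec f] cover [spec s], by primality.  The
    prime filters come from Zorn's lemma, and distributivity of [A] is what
    makes a filter maximal among those avoiding [u] prime.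

    Downsets closed under a class of admissible joins form a sublocale as soon
    as the class is stable under meeting with an element of [A]; both ends
    of the interval are of this kind.

    Let [S] be a sublocale between them.  It is a frame, as is any sublocale of
    a frame.  It contains the principal downsets, which are D-ideals and form a
    base.  The joins in [S] of finitely many principal downsets agree with those
    of [A] because the elements of [S] are closed under finite joins.

    Let finally [L] be a frame with D-base [A].  The set of [a] below a given
    [x] in [L] is closed under finite joins because the embedding preserves
    them.  If [E] is a D-ideal with join [x] in [L], then by the frame law each
    [a] below [x] is the join of the [a /\ e] with [e] in [E]; this join is
    admissible in [A], so [a] lies in [E], and [E] is the trace of [x]. *)

(** * Frames and their sublocales *)

Section Bounds.
Variables (d : Order.disp_t) (L : porderType d).
Implicit Types (X S : set L) (x y s m u : L).

Lemma supremumsP X s : supremums X s <-> forall u, s <= u <-> ubound X u.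
Proof.
split=> [[ubs lbs] u|Xs].
  by split=> [su x /ubs xs|/lbs//]; apply: le_trans su.
by split=> [|u Xu]; [apply/Xs | apply/Xs].
Qed.

Lemma infimumsP X m : infimums X m <-> forall z, z <= m <-> lbound X z.
Proof.
split=> [[lbm ubm] z|Xm].
  by split=> [zm x /lbm mx|/ubm//]; apply: le_trans mx.
by split=> [|z Xz]; [apply/Xm | apply/Xm].
Qed.

Lemma infimums2P x y m :
  infimums [set x; y] m <-> forall z, z <= m <-> z <= x /\ z <= y.
Proof.
have lb2 z : lbound [set x; y] z <-> z <= x /\ z <= y.
  split=> [lbz|[zx zy] t [->|->]//]; split; apply: lbz; [by left|by right].
by rewrite infimumsP; split=> xym z; rewrite xym lb2.
Qed.

End Bounds.

Section Frames.
Variables (d : Order.disp_t) (L : porderType d).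
Implicit Types (X S : set L) (x y s m u : L).

Lemma frame_infimums : is_frame L -> forall X, infimums X !=set0.
Proof.
case=> sup _ X; have [m [ubm lbm]] := sup (lbound X).
exists m; split=> [x Xx|z Xz]; last exact: ubm.
by apply: lbm => z; apply.
Qed.

(** The implication [x => y] is the join of all [z] with [z /\ x <= y]; the
    frame law says that this join still has the property. *)
Lemma frame_heyting_imp : is_frame L ->
  forall x y, exists h, is_heyting_imp x y h.
Proof.
move=> frL x y; have [sup distr] := frL.
pose Z := [set z | forall m, infimums [set z; x] m -> m <= y].
have [h hsup] := sup Z; exists h => z; split=> [zh m|Zz]; last first.
  by case: hsup => ubh _; apply: ubh.
move=> /infimums2P mP; have [n nP] := frame_infimums frL [set x; h].
have [_ lbn] := distr _ _ _ _ hsup nP.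
have /mP [mz mx] := lexx m.
apply: (@le_trans _ _ n).
  by move/infimums2P: nP => nP; apply/nP; split=> //; apply: le_trans zh.
by apply: lbn => w [t Zt]; rewrite setUC => /(Zt w).
Qed.

(** A sublocale is closed under the meets of the ambient frame, so that meets
    computed in it and in the frame agree. *)
Lemma sublocale_infimums S (X : set (set_type S)) (m : set_type S) :
  is_frame L -> is_sublocale S -> infimums X m -> infimums (val @` X) (val m).
Proof.
move=> frL [Sinf _] /infimumsP mP.
have [n nP] := frame_infimums frL (val @` X).
have Sn : S n by apply: Sinf nP => _ [x _ <-]; apply/set_mem/(valP x).
pose n' : set_type S := exist _ n (mem_set Sn).
suff -> : m = n' by [].
move/infimumsP: nP => nP; apply: le_anti; apply/andP; split.
  apply/(nP (val m)) => _ [x Xx <-].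
  by have /mP/(_ x Xx) := lexx m.
apply/mP => x Xx.
by have /nP/(_ (val x)) := lexx n; apply; exists x.
Qed.

(** The join of a family in a sublocale [S] is the meet of its upper bounds in
    [S].  The distributive law holds because [S] is closed under implication:
    if [u] in [S] is above all the [x /\ y], then [x => u] is an element of [S]
    above all the [y], hence above their join computed in [S]. *)
Lemma sublocale_is_frame S :
  is_frame L -> is_sublocale S -> is_frame (set_type S).
Proof.
move=> frL Ssub; have [Sinf Simp] := Ssub.
have SP (x : set_type S) : S (val x) by apply/set_mem/(valP x).
split=> [X|X x s m sP mP].
  have [t tP] := frame_infimums frL (val @` ubound X).
  have St : S t by apply: Sinf tP => _ [u _ <-].
  exists (exist _ t (mem_set St) : set_type S).
  move/infimumsP: tP => tP; split=> [x Xx|u Xu].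
    by apply/(tP (val x)) => _ [u Xu <-]; apply: Xu.
  by have /tP/(_ (val u)) := lexx t; apply; exists u.
move/supremumsP: sP => sP; have /sP ubs := lexx s.
move/infimums2P: (mP) => mP'; have /mP' [mx ms] := lexx m.
split=> [z [y Xy /infimums2P zP]|u uP].
  have /zP [zx zy] := lexx z.
  by apply/mP'; split=> //; apply: (le_trans zy); apply: ubs.
have [h hP] := frame_heyting_imp frL (val x) (val u).
have Sh : S h by apply: Simp hP.
suff sh : s <= (exist _ h (mem_set Sh) : set_type S).
  have /hP/(_ (val m)) := sh; apply.
  move: (sublocale_infimums frL Ssub mP).
  by rewrite image_setU !image_set1 setUC.
apply/sP => y Xy; apply/(hP (val y)) => w wP.
have Sw : S w by apply: Sinf wP => _ [] ->; apply: SP.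
apply: (uP (exist _ w (mem_set Sw) : set_type S)); exists y => //.
move/infimums2P: wP => wP; apply/infimums2P => z.
exact: iff_trans (wP (val z)) (and_comm _ _).
Qed.

End Frames.

(** * Downsets *)

Section Downsets.
Variables (d : Order.disp_t) (A : meetSemilatticeType d).
Implicit Types (E F H : downsets A) (a b c g : A) (G : set A).

Definition to_downset (P : set A) (dP : is_downset P) : downsets A :=
  exist _ P (mem_set dP).

Lemma downsetP E : is_downset (val E).
Proof. exact/set_mem/(valP E). Qed.

Lemma downset_leP E F : E <= F <-> val E `<=` val F.
Proof. by rewrite -subsetEset; exact: iff_refl. Qed.

Lemma downset_ext E F : (forall a, val E a <-> val F a) -> E = F.
Proof. by move=> EF; apply/val_inj/funext => a; apply/propext. Qed.

Lemma principal_leP a E : principal a <= E <-> val E a.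
Proof.
rewrite downset_leP; split=> [|Ea b ba]; first by apply; exact: lexx.
exact: downsetP Ea.
Qed.

Lemma downset_infimumsP (X : set (downsets A)) E :
  infimums X E <-> forall a, val E a <-> forall F, X F -> val F a.
Proof.
split=> [/infimumsP XE a|XE].
  rewrite -principal_leP XE.
  by split=> Xa F XF; apply/principal_leP/Xa.
apply/infimumsP => F; split=> [/downset_leP FE H XH|XF].
  by apply/downset_leP => a /FE/XE; apply.
by apply/downset_leP => a Fa; apply/XE => H /XF/downset_leP; apply.
Qed.

Lemma downset_infimums2P E F H :
  infimums [set E; F] H <-> forall a, val H a <-> val E a /\ val F a.
Proof.
have in2 a : (forall I, [set E; F] I -> val I a) <-> val E a /\ val F a.
  by split=> [EFa|[Ea Fa] I [->|->]//]; split; apply: EFa; [left|right].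
by rewrite downset_infimumsP; split=> HP a; rewrite HP in2.
Qed.

Lemma bigcup_downset (X : set (downsets A)) :
  is_downset (\bigcup_(F in X) val F).
Proof. by move=> a b ab [F XF Fb]; exists F => //; apply: downsetP Fb. Qed.

Lemma downset_supremumsP (X : set (downsets A)) E :
  supremums X E <-> forall a, val E a <-> exists2 F, X F & val F a.
Proof.
have dU := @bigcup_downset X.
have UP : supremums X (to_downset dU).
  split=> [F XF|F XF]; apply/downset_leP => a; first by exists F.
  by case=> H /XF/downset_leP; apply.
split=> [XE|XE]; first by rewrite (is_subset1_supremums XE UP).
by rewrite (_ : E = to_downset dU)//; apply: downset_ext.
Qed.

Lemma downsets_is_frame : is_frame (downsets A).
Proof.
split=> [X|X E S M].
  by exists (to_downset (@bigcup_downset X)); apply/downset_supremumsP.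
move=> /downset_supremumsP SP /downset_infimums2P MP.
apply/downset_supremumsP => a; rewrite MP SP; split=> [[Ea [F XF Fa]]|].
  have dI : is_downset (val E `&` val F).
    by move=> b c bc [Ec Fc]; split; apply: downsetP bc _.
  by exists (to_downset dI) => //; exists F => //; apply/downset_infimums2P.
by case=> I [F XF /downset_infimums2P IP] /IP [Ea Fa]; split=> //; exists F.
Qed.

Lemma downset_heyting_impP E F H : is_heyting_imp E F H ->
  forall a, val H a <-> forall b, val E b -> val F (Order.meet a b).
Proof.
move=> HP a; rewrite -principal_leP HP; split=> [aE b Eb|aE M].
  have dI : is_downset ([set c | c <= a] `&` val E).
    move=> c e ce [ea Ee]; split; [exact: le_trans ea | exact: downsetP Ee].
  have /downset_leP : to_downset dI <= F.
    by apply: aE; apply/downset_infimums2P.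
  apply; split; first exact: leIl.
  by apply: downsetP Eb; apply: leIr.
move=> /downset_infimums2P MP; apply/downset_leP => b /MP [ba Eb].
by have := aE b Eb; rewrite (meet_idPr ba).
Qed.

End Downsets.

(** * Downsets closed under a class of admissible joins *)

Section Closed.
Variables (d : Order.disp_t) (A : meetSemilatticeType d).
Implicit Types (E F H : downsets A) (a b c g u : A) (G : set A).

Definition closed_under (K : set A -> Prop) : set (downsets A) :=
  [set E | forall G g, K G -> admissible G -> G `<=` val E ->
     supremums G g -> val E g].

Lemma Dideals_closed : Dideals A = closed_under (fun=> True).
Proof.
apply/seteqP; split=> E EP G g; [move=> _|move=> adm]; [exact: EP|].
exact: EP.
Qed.

Lemma admissible_distr G g a : admissible G -> supremums G g ->
  supremums [set Order.meet a y | y in G] (Order.meet a g).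
Proof. by case=> h hP + gP; rewrite (is_subset1_supremums gP hP); apply. Qed.

Lemma image_meet_image_meet a b G :
  [set Order.meet b z | z in [set Order.meet a y | y in G]] =
  [set Order.meet (Order.meet b a) y | y in G].
Proof. by rewrite image_comp; apply: eq_imagel => y _ /=; rewrite meetA. Qed.

Lemma admissible_meet G a : admissible G ->
  admissible [set Order.meet a y | y in G].
Proof.
case=> g gP adm; exists (Order.meet a g); first exact: adm.
by move=> b; rewrite meetA image_meet_image_meet; exact: adm.
Qed.

(** Closure under implication [E => F] is where admissibility enters: a family
    [G] in [E => F] is sent by each [b] of [E] to the family of the [b /\ y] of
    [F], which is again admissible, with join [b /\ \/ G]. *)
Lemma closed_under_sublocale K :
  (forall G a, K G -> K [set Order.meet a y | y in G]) ->
  is_sublocale (closed_under K).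
Proof.
move=> Kmeet; split=> [X M XK /downset_infimumsP MP|
  E F H FK /downset_heyting_impP HP].
  move=> G g KG aG GM gP; apply/MP => E XE.
  by apply: (XK E XE G) => // a /GM /MP; apply.
move=> G g KG aG GH gP; apply/HP => b Eb; rewrite meetC.
apply: (FK [set Order.meet b y | y in G]).
- exact: Kmeet.
- exact: admissible_meet.
- by move=> _ [y Gy <-]; rewrite meetC; apply: (HP y).1 => //; apply: GH.
- exact: admissible_distr.
Qed.

Lemma principal_Dideal a : Dideals A (principal a).
Proof. by move=> G g _ Ga [_]; apply. Qed.

End Closed.

(** * Prime filters and the distributive envelope *)

Lemma set_seq_cons (T : eqType) (x : T) (s : seq T) :
  [set` x :: s] = x |` [set` s].
Proof.
apply/seteqP; split=> y; rewrite /= inE.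
  by case/orP=> [/eqP|]; [left|right].
by case=> [->|ys]; apply/orP; [left|right].
Qed.

Section Envelope.
Variables (d : Order.disp_t) (A : meetSemilatticeType d).
Hypothesis distrA : distributive_semilattice A.
Implicit Types (E : downsets A) (a b c f g u : A) (F G P : set A).

Lemma prime_filterP (P : prime_filters A) : is_prime_filter (val P).
Proof. exact/set_mem/(valP P). Qed.

Lemma spec_le a b : a <= b -> spec a `<=` spec b.
Proof. by move=> ab P; have [[_ up _] _ _] := prime_filterP P; apply: up. Qed.

Lemma upset_filter a : is_filter [set b | a <= b].
Proof.
split; first by exists a => /=.
- by move=> b c bc /= ab; apply: le_trans bc.
- by move=> b c /= ab ac; rewrite lexI ab.
Qed.

(** A filter maximal among those that avoid [u] is prime: if it contains
    neither [F] nor [G], then [p /\ f <= u] and [p /\ g <= u] with [p] in [P],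
    [f] in [F], [g] in [G], and two applications of distributivity factor [u]
    as a meet of elements of [P] and an element of [F `&` G]. *)
Lemma maximal_filter_prime P u : is_filter P -> ~ P u ->
  (forall Q, is_filter Q -> P `<=` Q -> ~ Q u -> Q `<=` P) ->
  is_prime_filter P.
Proof.
move=> [P0 Pup Pmeet] Pu Pmax; split=> //.
  by move=> PT; apply: Pu; rewrite PT.
have [p0 Pp0] := P0.
(* The filter generated by [P] and [F] contains [u] as soon as [P] does not
   contain [F]. *)
have join F : is_filter F -> ~ F `<=` P ->
    exists p f, [/\ P p, F f & Order.meet p f <= u].
  move=> [[f0 Ff0] Fup Fmeet] FP; apply: contrapT => noP; apply: FP.
  pose Q := [set c | exists p f, [/\ P p, F f & Order.meet p f <= c]].
  suff QP : Q `<=` P by move=> f Ff; apply: QP; exists p0, f; rewrite leIr.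
  apply: Pmax => //; last by move=> p Pp; exists p, f0; rewrite leIl.
  split; first by exists (Order.meet p0 f0), p0, f0.
    move=> a b ab [p [f [Pp Ff pfa]]]; exists p, f; split=> //.
    exact: le_trans ab.
  move=> a b [p [f [Pp Ff pfa]]] [q [g [Pq Fg qgb]]].
  exists (Order.meet p q), (Order.meet f g).
  split; [exact: Pmeet|exact: Fmeet|].
  by rewrite meetACA leI2.
move=> F G fF fG FGP; apply: contrapT => /not_orP [FP GP].
have [p [f [Pp Ff pfu]]] := join F fF FP.
have [q [g [Pq Gg qgu]]] := join G fG GP.
have [p' [f' [pp' ff' uE]]] := distrA pfu.
have qgf' : Order.meet q g <= f' by apply: le_trans qgu _; rewrite -uE leIr.
have [q' [g' [qq' gg' f'E]]] := distrA qgf'.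
have Pg' : P g'.
  apply: FGP; split; last by case: fG => _ up _; apply: up Gg.
  case: fF => _ up _; apply: up Ff.
  by apply: (le_trans ff'); rewrite -f'E leIr.
apply: Pu; rewrite -uE -f'E; apply: (Pmeet); first exact: Pup Pp.
by apply: Pmeet => //; apply: Pup Pq.
Qed.

Lemma prime_filter_separation a u : ~ a <= u ->
  exists P : prime_filters A, spec a P /\ ~ spec u P.
Proof.
move=> au.
(* The empty set is let in, to serve as a bound for the empty chain. *)
pose Fam := [set P : set A |
  [/\ forall b c, b <= c -> P b -> P c,
      forall b c, P b -> P c -> P (Order.meet b c),
      forall b, P b -> P a & ~ P u]].
have [|P [[Pup Pmeet Pa Pu] Pmax]] := @Zorn_bigcup _ Fam.
  move=> C CF Ctot; split.
  - move=> b c bc [P CP Pb]; exists P => //.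
    by case: (CF P CP) => up _ _ _; apply: up Pb.
  - move=> b c [P CP Pb] [Q CQ Qc].
    have [_ Pmeet _ _] := CF P CP; have [_ Qmeet _ _] := CF Q CQ.
    have [PQ|QP] := Ctot P Q CP CQ.
      by exists Q => //; apply: Qmeet => //; apply: PQ.
    by exists P => //; apply: Pmeet => //; apply: QP.
  - move=> b [P CP Pb]; exists P => //.
    by case: (CF P CP) => _ _ + _; apply; exact: Pb.
  - by case=> P CP; case: (CF P CP).
have Pmax' Q : Fam Q -> P `<=` Q -> Q `<=` P.
  move=> FQ PQ; apply: contrapT => QP.
  by apply: (Pmax Q) => //; split.
have Pa' : P a.
  apply: contrapT => nPa; apply: (nPa); apply: (Pmax' [set b | a <= b]) => /=.
  - have [_ up meet] := upset_filter a.
    by split=> //= b _.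
  - by move=> b /Pa.
  - exact: lexx.
have Pprime : is_prime_filter P.
  apply: (@maximal_filter_prime _ u) => //; first by split=> //; exists a.
  move=> Q [_ Qup Qmeet] PQ Qu; apply: Pmax' => //; split=> // b _.
  exact: PQ.
by exists (exist _ P (mem_set Pprime)).
Qed.

Lemma spec_leP a b : spec a `<=` spec b <-> a <= b.
Proof.
split=> [ab|/spec_le//]; apply: contrapT => /prime_filter_separation[P [Pa]].
by apply; apply: ab.
Qed.

(** An upper bound [u] of the [a /\ f] lies in every prime filter that contains
    [a], hence is above [a]. *)
Lemma spec_cover_supremums a F : spec a `<=` \bigcup_(f in F) spec f ->
  supremums [set Order.meet a f | f in F] a.
Proof.
move=> aF; split=> [_ [f _ <-]|u uF]; first exact: leIl.
apply: contrapT => /prime_filter_separation [P [Pa Pu]]; apply: Pu.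
have [f Ff Pf] := aF P Pa; have [[_ Pup Pmeet] _ _] := prime_filterP P.
by apply: (Pup (Order.meet a f)); [apply: uF; exists f|apply: Pmeet].
Qed.

Lemma spec_cover_admissible a F : spec a `<=` \bigcup_(f in F) spec f ->
  admissible [set Order.meet a f | f in F].
Proof.
move=> aF; exists a; first exact: spec_cover_supremums.
move=> b; rewrite image_meet_image_meet.
apply: spec_cover_supremums; apply: subset_trans aF; apply: spec_le.
exact: leIr.
Qed.

(** The upper bounds of [F] are the intersection of the principal filters of
    its elements, so a prime filter that contains all these bounds contains one
    of the principal filters. *)
Lemma spec_supremum F s : finite_set F -> F !=set0 -> supremums F s ->
  spec s `<=` \bigcup_(f in F) spec f.
Proof.
move=> /finite_seqP[l ->] l0 [ubs lbs] P Ps.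
have [[_ Pup _] _ Pprime] := prime_filterP P.
have : ubound [set` l] `<=` val P by move=> u /lbs su; apply: Pup Ps.
elim: l l0 ubs {lbs} => [[? //]|f l IHl _]; rewrite set_seq_cons => ubs ubP.
have ubs' : ubound [set` l] s by move=> g lg; apply: ubs; right.
have fub : is_filter (ubound [set` l]).
  split; first by exists s.
  - by move=> a b ab ua g /ua ga; apply: le_trans ab.
  - by move=> a b ua ub g lg; rewrite lexI ua// ub.
have [|fP|lP] := Pprime _ _ (upset_filter f) fub.
- by move=> u [/= fu ulu]; apply: ubP => g [->//|/ulu].
- by exists f; [left | apply: fP; exact: lexx].
have [l0|/nonemptyPn l0] := pselect ([set` l] !=set0).
  have [g lg Pg] := IHl l0 ubs' lP.
  by exists g => //; right.
by exists f; [left | apply: lP; rewrite l0].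
Qed.

Lemma spec_least a : (forall b, a <= b) -> spec a = set0.
Proof.
move=> amin; rewrite -subset0 => P Pa; have [[_ Pup _] PT _] := prime_filterP P.
by apply: PT; apply/seteqP; split=> // b _; apply: Pup Pa.
Qed.

Lemma envelope_spec a : envelope (spec a).
Proof.
by exists [set a]; rewrite bigcup_set1; split=> //; exists a.
Qed.

Lemma envelope_setU U V : envelope U -> envelope V ->
  envelope (U `|` V : set (prime_filters A)).
Proof.
move=> [F [fF [f Ff] ->]] [G [fG _ ->]]; exists (F `|` G).
by rewrite finite_setU bigcup_setU; split=> //; exists f; left.
Qed.

Lemma envelope_ideal_bigcup I F : is_envelope_ideal I -> finite_set F ->
  F !=set0 -> F `<=` @spec d A @^-1` I -> I (\bigcup_(f in F) spec f).
Proof.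
move=> [_ _ _ IU] /finite_seqP[l ->]; elim: l => [[? //]|f l IHl] _.
rewrite set_seq_cons bigcup_setU bigcup_set1 => lI.
have If : I (spec f) by apply: lI; left.
have [l0|/nonemptyPn ->] := pselect ([set` l] !=set0); last first.
  by rewrite bigcup_set0 setU0.
by apply: IU => //; apply: IHl => // g lg; apply: lI; right.
Qed.

(** For the empty join, note that a least element of [A] has an empty [spec],
    which belongs to each nonempty ideal; and it is then the least element of
    the envelope, so that the empty ideal is excluded. *)
Lemma trace_closed_under_finite_joins E F s :
  envelope_sublocale A E -> finite_set F -> F `<=` val E -> supremums F s ->
  val E s.
Proof.
move=> [I II ->] fF FI sP.
have [F0|/nonemptyPn F0] := pselect (F !=set0).
  case: II => [II|[I0 _]]; last first.
    by case: F0 => f /FI; rewrite /preimage/= I0.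
  have [_ _ Idown _] := II.
  apply: Idown (spec_supremum fF F0 sP); first exact: envelope_spec.
  exact: envelope_ideal_bigcup.
have s0 : spec s = set0.
  by apply: spec_least => b; case: sP => _; apply; rewrite F0.
have e0 : envelope (@set0 (prime_filters A))
  by rewrite -s0; exact: envelope_spec.
rewrite /preimage/= s0; case: II => [[_ [U IU] Idown _]|[_ noleast]].
  by apply: Idown e0 IU _; exact: sub0set.
by case: noleast; exists set0 => // V _; exact: sub0set.
Qed.

(** A nonempty [E] is the trace of the ideal that the [spec a] with [a] in [E]
    generate.  The empty [E] is the trace of the empty ideal, which is allowed:
    if the envelope had a least element, any [spec f] below it would make [f]
    least in [A], by separation, whereas [E] contains all least elements. *)
Lemma spec_closed_trace E :
  (forall F a, finite_set F -> F !=set0 -> F `<=` val E ->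
     spec a `<=` \bigcup_(f in F) spec f -> val E a) ->
  (forall a, (forall b, a <= b) -> val E a) ->
  envelope_sublocale A E.
Proof.
move=> cover least.
pose I := [set U | envelope U /\ exists F, [/\ finite_set F, F !=set0,
  F `<=` val E & U `<=` \bigcup_(f in F) spec f]].
have EI : val E = @spec d A @^-1` I.
  apply/seteqP; split=> a; last by case=> _ [F []]; apply: cover.
  move=> Ea; split; first exact: envelope_spec.
  exists [set a]; split=> //; first by exists a.
    by move=> _ ->.
  by rewrite bigcup_set1.
exists I => //.
have [[a Ea]|/nonemptyPn E0] := pselect (val E !=set0); [left|right].
  split; first by move=> U [].
  - by exists (spec a); move: Ea; rewrite EI.
  - move=> U V eU [_ [F [fF F0 FE VF]]] UV; split=> //.
    by exists F; split=> //; apply: subset_trans VF.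
  - move=> U V [eU [F [fF [f Ff] FE UF]]] [eV [G [fG G0 GE VG]]].
    split; first exact: envelope_setU.
    exists (F `|` G); rewrite finite_setU bigcup_setU; split=> //.
    + by exists f; left.
    + by move=> g [/FE|/GE].
    + exact: setUSS.
split.
  rewrite -subset0 => U [_ [F [_ [f Ff] FE _]]].
  by have := FE f Ff; rewrite E0.
move=> [U [F [_ [f Ff] ->]] Umin].
have : val E f; last by rewrite E0.
apply: least => b; apply/spec_leP.
by apply: subset_trans (Umin _ (envelope_spec b)); apply: bigcup_sup.
Qed.

(** In a distributive meet-semilattice all existing finite joins are
    admissible, so that the traces of the ideals of the envelope are to finite
    joins what the D-ideals are to all admissible ones. *)
Lemma envelope_sublocale_closed :
  envelope_sublocale A = closed_under (@finite_set A).
Proof.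
apply/seteqP; split=> E EP.
  by move=> F s fF _; apply: trace_closed_under_finite_joins.
apply: spec_closed_trace => [F a fF F0 FE aF|a amin].
  apply: (EP _ _ _ (spec_cover_admissible aF)).
  - exact: finite_image.
  - by move=> _ [f /FE Ef <-]; apply: downsetP Ef; exact: leIr.
  - exact: spec_cover_supremums.
have a0 : supremums set0 a by split=> [? []|b _].
apply: (EP set0) => //; exists a => // b.
by rewrite image_set0 meetC (meet_idPl (amin b)).
Qed.

End Envelope.

(** * Frames with a D-base *)

Section DbaseOfSublocale.
Variables (d : Order.disp_t) (A : meetSemilatticeType d).
Hypothesis distrA : distributive_semilattice A.
Variable S : set (downsets A).
Hypotheses (DS : Dideals A `<=` S) (SE : S `<=` envelope_sublocale A).

Definition principal_in (a : A) : set_type S :=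
  exist _ (principal a) (mem_set (DS (@principal_Dideal _ _ a))).

Lemma principal_in_leP a (E : set_type S) :
  principal_in a <= E <-> val (val E) a.
Proof. by rewrite -principal_leP. Qed.

Lemma principal_in_Dbase : is_Dbase principal_in.
Proof.
split=> //.
- move=> a b; apply/idP/idP; first by move/principal_in_leP.
  by move=> ab; apply/principal_in_leP.
- move=> E; exists (principal_in @` val (val E)); first exact: image_subset.
  apply/supremumsP => F; split=> [EF _ [a Ea <-]|EF].
    apply/principal_in_leP; move: a Ea; exact/downset_leP.
  apply/downset_leP => a Ea; apply/principal_in_leP.
  by apply: EF; exists a.
split=> [a b|F s fF sP].
  apply/infimums2P => E; rewrite -[_ <-> _]/(val E <= principal _ <->
    val E <= principal a /\ val E <= principal b) !downset_leP.
  split=> [Eab|[Ea Eb] c Ec]; last by rewrite /= lexI Ea// Eb.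
  by split=> c /Eab /=; rewrite lexI => /andP[].
apply/supremumsP => E; rewrite principal_in_leP; split=> [Es _ [f Ff <-]|EF].
  apply/principal_in_leP; apply: downsetP Es; exact: sP.1.
have EE : envelope_sublocale A (val E) by apply/SE/set_mem/(valP E).
apply: (trace_closed_under_finite_joins EE fF) (sP) => f Ff.
by apply/principal_in_leP/EF; exists f.
Qed.

End DbaseOfSublocale.

Section SublocaleOfDbase.
Variables (d d' : Order.disp_t) (A : meetSemilatticeType d) (L : porderType d').
Variable i : A -> L.
Hypotheses (frL : is_frame L) (iD : is_Dbase i).

(** For the implication [E => F] with [F] the trace of [x], the witness [w] is
    the join in [L] of the elements of [E => F]: for [b] in [E], the frame law
    makes [i b /\ w] the join of the [i (b /\ c)] with [c] in [E => F], all of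
    which are below [x]. *)
Lemma sublocale_of_sublocale : is_sublocale (sublocale_of i).
Proof.
have [i_le _ _ [i_meet _]] := iD; have [sup distr] := frL.
split=> [X M XL /downset_infimumsP MP|E F H [x Fx] /downset_heyting_impP HP].
  pose Y := [set x | exists2 E, X E & val E = [set a | i a <= x]].
  have [y /infimumsP yP] := frame_infimums frL Y.
  exists y; apply/seteqP; split=> a.
    move=> /MP Ma; apply/yP => x [E XE Ex].
    by have := Ma E XE; rewrite Ex.
  move=> /= /yP ya; apply/MP => E XE; have [x Ex] := XL E XE.
  by rewrite Ex; apply: ya; exists E.
have [w wP] := sup (i @` val H).
have [ubw _] := wP.
exists w; apply/seteqP; split=> a; first by move=> Ha; apply: ubw; exists a.
move=> /= aw; apply/HP => b Eb; rewrite Fx /=.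
have [n nP] := frame_infimums frL [set i b; w].
have [_ lbn] := distr _ _ _ _ wP nP.
have /infimums2P nP' := nP.
apply: (@le_trans _ _ n).
  apply/nP'; rewrite i_le leIr; split=> //.
  by apply: le_trans aw; rewrite i_le leIl.
apply: lbn => z [_ [c Hc <-]] zP.
rewrite (is_subset1_infimums zP (i_meet b c)) meetC.
by have := (HP c).1 Hc b Eb; rewrite Fx.
Qed.

(** If [i a] is below the join of [i @` E], then by the frame law it is the
    join of the [i (a /\ e)]; so [a] is the join of the [a /\ e] in [A], and
    this join is admissible since the same applies to each [b /\ a]. *)
Lemma Dideals_sub_sublocale_of : Dideals A `<=` sublocale_of i.
Proof.
have [i_le _ _ [i_meet _]] := iD; have [sup distr] := frL.
move=> E ED; have [x xP] := sup (i @` val E); have [ubx _] := xP.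
have join a : i a <= x -> supremums [set Order.meet a e | e in val E] a.
  move=> ax; split=> [_ [e _ <-]|u uE]; first exact: leIl.
  rewrite -i_le.
  have aP : infimums [set i a; x] (i a).
    by apply/infimums2P => z; split=> [za|[]//]; split=> //; apply: le_trans ax.
  have [_] := distr _ _ _ _ xP aP; apply=> z [_ [e Ee <-] zP].
  rewrite (is_subset1_infimums zP (i_meet a e)) i_le; apply: uE; by exists e.
exists x; apply/seteqP; split=> a /=; first by move=> Ea; apply: ubx; exists a.
move=> ax; apply: ED (join a ax); last first.
  by move=> _ [e Ee <-]; apply: downsetP Ee; exact: leIr.
exists a; first exact: join.
move=> b; rewrite image_meet_image_meet.
by apply: join; apply: le_trans ax; rewrite i_le leIr.
Qed.

Lemma sublocale_of_sub_envelope_sublocale :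
  sublocale_of i `<=` envelope_sublocale A.
Proof.
have [i_le _ distrA [_ i_sup]] := iD.
rewrite envelope_sublocale_closed// => E [x Ex] F s fF _ FE sP.
rewrite Ex /=; have [_] := i_sup F s fF sP; apply=> _ [f Ff <-].
by have := FE f Ff; rewrite Ex.
Qed.

End SublocaleOfDbase.

Theorem theorem5p17 (d : Order.disp_t) (A : meetSemilatticeType d)
    (distrA : distributive_semilattice A) :
  [/\ is_sublocale (Dideals A),
      is_sublocale (envelope_sublocale A),
      (forall S : set (downsets A), is_sublocale S ->
         Dideals A `<=` S -> S `<=` envelope_sublocale A ->
         is_frame (set_type S) /\
         exists2 i : A -> set_type S,
           (forall a : A, val (i a) = principal a) & is_Dbase i)
    & (forall (d' : Order.disp_t) (L : porderType d') (i : A -> L),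
         is_frame L -> is_Dbase i ->
         [/\ is_sublocale (sublocale_of i),
             Dideals A `<=` sublocale_of i
           & sublocale_of i `<=` envelope_sublocale A])].
Proof.
split.
- by rewrite Dideals_closed; apply: closed_under_sublocale.
- rewrite envelope_sublocale_closed//; apply: closed_under_sublocale => G a.
  exact: finite_image.
- move=> S Ssub DS SE; split.
    by apply: sublocale_is_frame Ssub; exact: downsets_is_frame.
  by exists (principal_in DS) => //; exact: principal_in_Dbase.
- move=> d' L i frL iD; split.
  + exact: sublocale_of_sublocale.
  + exact: Dideals_sub_sublocale_of.
  + exact: sublocale_of_sub_envelope_sublocale.
Qed.
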